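(* Let $\xi_1,\xi_2,\dots$ be independent random variables with $P\{\xi_k=m\}=p_{mk}\ge0$ for $m\in\mathbb N$, $\sum_m p_{mk}=1$, and let $\xi=\sum_{n=1}^\infty\frac{(-1)^{n-1}}{\xi_1(\xi_1+\xi_2)\cdots(\xi_1+\dots+\xi_n)}$. Then the distribution of $\xi$ is of pure type: it is either purely discrete, or purely singular continuous, or purely absolutely continuous. *)

(* Defs.v *)
From HB Require Import structures.
From mathcomp Require Import all_boot all_order all_algebra finmap.
From mathcomp Require Import all_classical all_reals all_analysis.
From mathcomp Require Import measurable_realfun.

Set Implicit Arguments.
Unset Strict Implicit.
Unset Printing Implicit Defensive.

Import Order.TTheory GRing.Theory Num.Theory.
Import numFieldNormedType.Exports.

Local Open Scope classical_set_scope.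
Local Open Scope ring_scope.

Section measurability.
Context d (T : measurableType d) (R : realType).

Lemma measurable_inv (f : T -> R) :
  measurable_fun setT f -> measurable_fun setT (fun x => (f x)^-1).
Proof.
move=> mf; apply: (measurableT_comp _ mf).
rewrite (_ : GRing.inv = fun x : R => if x == 0 then 0 else x^-1); last first.
  by apply/funext => x; case: eqP => // ->; rewrite invr0.
apply: measurable_fun_if => //.
- exact: measurable_fun_eqr.
- rewrite setTI (_ : _ @^-1` _ = ~` [set 0]); last first.
    by apply/seteqP; split=> x /= => [/negbT/eqP|/eqP/negbTE].
  apply: open_continuous_measurable_fun.
    by rewrite openC; exact: closed_eq.
  by move=> x /set_mem/eqP x0; exact: inv_continuous.
Qed.

Lemma measurable_limn (h : nat -> T -> R) :
  (forall n, measurable_fun setT (h n)) ->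
  measurable_fun setT (fun x => limn (h ^~ x)).
Proof.
move=> mh.
pose u x n := (h n x)%:E.
pose E x := limn_esup (u x).
pose I x := limn_einf (u x).
have mE : measurable_fun setT E.
  by apply: (measurable_fun_limn_esup (f := fun n x => u x n)) => n; exact/measurable_EFinP.
have mI : measurable_fun setT I.
  apply: measurableT_comp => //.
  apply: (measurable_fun_limn_esup (f := fun n x => - u x n)%E) => n.
  by apply: measurableT_comp => //; exact/measurable_EFinP.
rewrite (_ : (fun x => _) =
  fun x => if (E x == I x) && (E x \is a fin_num) then fine (E x) else point).
  apply: measurable_fun_ifT.
  - apply: measurable_and; first exact: measurable_fun_eqe.
    apply: (measurable_fun_bool true) => //.
    exact: emeasurable_fin_num.
  - exact: measurableT_comp.
  - exact: measurable_cst.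
apply/funext => x; case: ifPn => [/andP[/eqP EI Ef]|H].
  have ul : u x @ \oo --> E x.
    apply: (@squeeze_cvge _ _ _ _ (einfs (u x)) _ (esups (u x))).
    - apply: nearW => n; apply/andP; split.
        by apply: ereal_inf_lbound; exists n => /=.
      by apply: ereal_sup_ubound; exists n => /=.
    - rewrite EI /I limn_einf_lim; exact: is_cvg_einfs.
    - rewrite /E limn_esup_lim; exact: is_cvg_esups.
  apply/cvg_lim => //.
  by move: ul; rewrite -[E x]fineK// => /fine_cvgP[].
apply: dvgP => /cvg_ex[l hl].
have ul : u x @ \oo --> l%:E by exact: cvg_EFin (nearW _ _) hl.
by move: H; rewrite /E /I !(cvg_limn_einf_sup ul) eqxx.
Qed.

End measurability.

Section series.
Context d (T : measurableType d) (R : realType) (P : probability T R).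
Variable xi : nat -> {RV P >-> R}.

(* The sequence is indexed from 0: [xi k] stands for $\xi_{k+1}$, so that term
   [n] is $(-1)^n / (\xi_1 (\xi_1 + \xi_2) \cdots (\xi_1 + \dots + \xi_{n+1}))$. *)
Definition ostrogradsky_term (n : nat) (w : T) : R :=
  (-1) ^+ n / \prod_(j < n.+1) \sum_(i < j.+1) xi i w.

(* The series converges at every [w] where all the [xi k w] are positive
   integers; where it diverges, [limn] is the default value of [R]. *)
Definition ostrogradsky_sum (w : T) : R :=
  limn (series (ostrogradsky_term ^~ w)).

Lemma measurable_ostrogradsky_sum : measurable_fun setT ostrogradsky_sum.
Proof.
apply: (measurable_limn
  (h := fun n w => \sum_(0 <= k < n) ostrogradsky_term k w)) => n.
apply: measurable_sum => k; apply: measurable_funM => //.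
apply: measurable_inv; apply: measurable_prod => j _.
by apply: measurable_sum => i; exact: measurable_funPT.
Qed.

HB.instance Definition _ :=
  isMeasurableFun.Build _ _ _ _ ostrogradsky_sum measurable_ostrogradsky_sum.

End series.

Definition mutually_independent d (T : measurableType d) (R : realType)
    (P : probability T R) (I : choiceType) (X : I -> {RV P >-> R}) : Prop :=
  forall (J : {fset I}) (A : I -> set R), (forall i, measurable (A i)) ->
    P (\bigcap_(i in [set` J]) (X i @^-1` A i)) =
    (\prod_(i <- J) P (X i @^-1` A i))%E.

Section types_of_distributions.
Context (R : realType).
Implicit Type mu : probability R R.

Definition purely_discrete mu : Prop :=
  exists2 C : set R, countable C & mu (~` C) = 0%E.

Definition purely_singular_continuous mu : Prop :=
  (forall x, mu [set x] = 0%E) /\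
  exists N : set R, [/\ measurable N, lebesgue_measure N = 0%E & mu (~` N) = 0%E].

Definition purely_absolutely_continuous mu : Prop :=
  mu `<< lebesgue_measure.

End types_of_distributions.

(* Main.v *)
Require Import Defs.
From mathcomp Require Import all_boot all_order all_algebra finmap.
From mathcomp Require Import all_classical all_reals all_analysis.
From mathcomp Require Import measurable_realfun ring lra.

(** Write [G_s(e)] for the alternating series with denominators
    [s + (e_0 + 1) + ... + (e_k + 1)], so that [xi = G_0(e)] with [e_k + 1 = xi_k].
    Let [I] be a sigma-ideal of Borel sets such that replacing the first [n]
    terms of [e] maps points of a set in [I] into a set in [I]. If [N] in [I]
    maximises [P(xi in N)], then [P(xi in N | prefix)] does not depend on the
    prefix, so [{xi in N}] is independent of all cylinders, hence of itself, and
    has probability 0 or 1. The theorem follows by applying this to countable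
    sets and to Lebesgue-null sets.

    Since [G_s(e) = (1 - G_t(e_1, e_2, ...)) / t] with [t = s + e_0 + 1], a change
    of prefix is a composition of affine maps and of shifts
    [G_s(e) |-> G_s'(e)]. For countable sets, injectivity of [G_s] suffices. For
    null sets, the shift from [s] to [s + 1] is 1-Lipschitz, and its inverse is
    Lipschitz on each set where the product of the [1 + 1/q_i] over the
    denominators [q_i] is bounded; the remaining points form a null set by a
    Markov-type estimate of the measure of the set where this product is large. *)

Set Implicit Arguments.
Unset Strict Implicit.
Unset Printing Implicit Defensive.

Import Order.TTheory GRing.Theory Num.Theory.
Import numFieldNormedType.Exports.

Local Open Scope classical_set_scope.
Local Open Scope ring_scope.

(** * Shifted Pierce expansions *)

Section succ_comparison.
Context (R : realType).
Implicit Types a b k t u : R.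

(** Here [a] and [b] stand for one quantity at shifts [s] and [s + 1], comparable up to [k]; for
    [t >= 1], replacing [t] by [t + 1] costs at most a further factor 2. *)
Lemma div_succ_bounds a b k t : 1 <= t -> 0 <= b -> b <= a -> a <= k * b ->
  b / (t + 1) <= a / t <= 2 * k * (b / (t + 1)).
Proof.
move=> t1 b0 ba akb; have t0 : 0 < t by lra.
have t10 : 0 < t + 1 by lra.
apply/andP; split.
  rewrite ler_pdivrMr// mulrAC ler_pdivlMr//; nra.
rewrite ler_pdivrMr//.
have -> : 2 * k * (b / (t + 1)) * t = (2 * k * b * t) / (t + 1) by ring.
rewrite ler_pdivlMr//; nra.
Qed.

(** The differences are [(u - t) / (t u)] and [(u - t) / ((t + 1) (u + 1))], whose denominators have
    ratio between 1 and 4. *)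
Lemma inv_sub_succ_bounds t u : 1 <= t -> t <= u ->
  [/\ 0 <= (t + 1)^-1 - (u + 1)^-1,
      (t + 1)^-1 - (u + 1)^-1 <= t^-1 - u^-1 &
      t^-1 - u^-1 <= 4 * ((t + 1)^-1 - (u + 1)^-1)].
Proof.
move=> t1 tu.
have tn : t != 0 by apply/eqP; lra.
have un : u != 0 by apply/eqP; lra.
have t1n : t + 1 != 0 by apply/eqP; lra.
have u1n : u + 1 != 0 by apply/eqP; lra.
have -> : (t + 1)^-1 - (u + 1)^-1 = (u - t) / ((t + 1) * (u + 1)) by field; apply/andP.
have -> : t^-1 - u^-1 = (u - t) / (t * u) by field; apply/andP.
have p1 : 0 < (t + 1) * (u + 1) by apply: mulr_gt0; lra.
have p2 : 0 < t * u by apply: mulr_gt0; lra.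
have ut : 0 <= u - t by lra.
split.
- by rewrite divr_ge0// ltW.
- rewrite ler_wpM2l// lef_pV2 ?posrE//; nra.
- rewrite mulrCA ler_wpM2l// ler_pdivlMr// mulrC ler_pdivrMr//; nra.
Qed.

End succ_comparison.

Lemma dist_sub_div (R : realType) (a b : R) (n : nat) :
  `|(1 - a) / n.+1%:R - (1 - b) / n.+1%:R| = `|a - b| / n.+1%:R.
Proof. by rewrite -mulrBl normrM normfV normr_nat opprB addrC addrA subrK distrC. Qed.

Section pierce.
Context (R : realType).
Implicit Types (s n k : nat) (e : nat -> nat).

Definition shiftn1 e : nat -> nat := fun i => e i.+1.

(* The sequence [e] encodes the differences [e k + 1], so that every sequence
   of naturals is admissible; the denominators are then
   [s + (e 0 + 1) + ... + (e k + 1)]. *)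
Fixpoint pierce_part n s e : R :=
  if n is n'.+1 then (1 - pierce_part n' (s + e 0).+1 (shiftn1 e)) / (s + e 0).+1%:R
  else 0.

Definition pierce s e : R := limn (fun n => pierce_part n s e).

Lemma pierce_part_bounds n s e : 0 <= pierce_part n s e <= s.+1%:R^-1.
Proof.
elim: n s e => [|n IH] s e /=; first by rewrite lexx invr_ge0 ler0n.
have /andP[h0 h1] := IH (s + e 0).+1 (shiftn1 e).
have h2 : pierce_part n (s + e 0).+1 (shiftn1 e) <= 1.
  by rewrite (le_trans h1)// invf_le1 ?ltr0n// ler1n.
apply/andP; split; first by rewrite divr_ge0 ?ler0n// subr_ge0.
rewrite (@le_trans _ _ ((s + e 0).+1%:R^-1))//.
  by rewrite ler_piMl ?invr_ge0 ?ler0n//; lra.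
by rewrite lef_pV2 ?posrE ?ltr0n// ler_nat ltnS leq_addr.
Qed.

(** The recursion divides the difference by the first denominator [t], and
    [2 / (t (t + 1)) <= 1 / (s + 1)] because [s + 1 <= t] and [2 <= t + 1]. *)
Lemma pierce_part_diff n s e :
  `|pierce_part n.+1 s e - pierce_part n s e| <= 2 / s.+1%:R * 2^-1 ^+ n.
Proof.
elim: n s e => [|n IH] s e.
  rewrite /= !subr0 mul1r expr0 mulr1 ger0_norm ?invr_ge0 ?ler0n//.
  have h : ((s + e 0).+1%:R^-1 : R) <= s.+1%:R^-1.
    by rewrite lef_pV2 ?posrE ?ltr0n// ler_nat ltnS leq_addr.
  apply: (le_trans h); rewrite ler_peMl ?invr_ge0 ?ler0n//; lra.
have pS m : pierce_part m.+1 s e =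
  (1 - pierce_part m (s + e 0).+1 (shiftn1 e)) / (s + e 0).+1%:R by [].
rewrite (pS n.+1) (pS n) -mulrBl.
rewrite opprB addrC addrA subrK -opprB.
rewrite normrM normrN normfV normr_nat ler_pdivrMr ?ltr0n//.
apply: (le_trans (IH _ _)).
have s1 : 1 <= s.+1%:R :> R by rewrite ler1n.
have st : s.+1%:R <= (s + e 0).+1%:R :> R by rewrite ler_nat ltnS leq_addr.
rewrite -[(s + e 0).+2]addn1 natrD.
move: (s.+1%:R : R) ((s + e 0).+1%:R : R) s1 st => a b a1 ab.
have a0 : 0 < a by lra.
have b0 : 0 < b + 1 by lra.
have c0 : 0 <= 2^-1 ^+ n :> R by rewrite exprn_ge0.
rewrite exprS; move: (_ ^+ n) c0 => c c0.
have -> : 2 / a * (2^-1 * c) * b = (b / a) * c by field; apply/eqP; lra.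
rewrite ler_wpM2r// (@le_trans _ _ 1)//; last by rewrite ler_pdivlMr; lra.
by rewrite ler_pdivrMr; lra.
Qed.

Lemma cvg_pierce_part s e : cvgn (fun n => pierce_part n s e).
Proof.
have -> : (fun n => pierce_part n s e) =
    series (fun n => pierce_part n.+1 s e - pierce_part n s e).
  apply/funext => n; rewrite /series /= telescope_sumr//.
  by rewrite /= subr0.
apply: normed_cvg.
apply: (@series_le_cvg _ _ (geometric (2 / s.+1%:R) 2^-1)).
- by move=> n; exact: normr_ge0.
- by move=> n; rewrite /geometric /= mulr_ge0 ?exprn_ge0// divr_ge0.
- by move=> n; exact: pierce_part_diff.
- by apply: is_cvg_geometric_series; rewrite ger0_norm//; lra.
Qed.

Lemma pierceE s e :
  pierce s e = (1 - pierce (s + e 0).+1 (shiftn1 e)) / (s + e 0).+1%:R.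
Proof.
have c1 : (fun n => pierce_part n.+1 s e) @ \oo --> pierce s e.
  by rewrite (cvg_shiftS (fun n => pierce_part n s e)); exact: cvg_pierce_part.
apply: (cvg_unique _ c1) => //=.
apply: cvgM; last exact: cvg_cst.
by apply: cvgB; [exact: cvg_cst|exact: cvg_pierce_part].
Qed.

Lemma pierce_ge0 s e : 0 <= pierce s e.
Proof.
apply: limr_ge; first exact: cvg_pierce_part.
by apply: nearW => n; have /andP[] := pierce_part_bounds n s e.
Qed.

Lemma pierce_le s e : pierce s e <= s.+1%:R^-1.
Proof.
apply: limr_le; first exact: cvg_pierce_part.
by apply: nearW => n; have /andP[] := pierce_part_bounds n s e.
Qed.

Lemma pierce_gt0 s e : 0 < pierce s e.
Proof.
rewrite pierceE divr_gt0 ?ltr0n// subr_gt0.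
by rewrite (le_lt_trans (pierce_le _ _))// invf_lt1 ?ltr0n// ltr1n.
Qed.

(** If [e] has first denominator [t], its tail is at most [1 / (t + 1)], so its value is at least
    [1 / (t + 1)]; a larger first denominator forces a smaller value. *)
Lemma pierce_head s e e' : (e 0 < e' 0)%N -> pierce s e' < pierce s e.
Proof.
move=> ee'; rewrite [ltRHS]pierceE [ltLHS]pierceE.
apply: (@lt_le_trans _ _ (s + e' 0).+1%:R^-1).
  by rewrite gtr_pMl ?invr_gt0 ?ltr0n// ltrBlDr ltrDl pierce_gt0.
apply: (@le_trans _ _ (s + e 0).+2%:R^-1).
  by rewrite lef_pV2 ?posrE ?ltr0n// ler_nat ltnS -addnS leq_add2l.
have := pierce_le (s + e 0).+1 (shiftn1 e).
move: (pierce _ _) => x; rewrite -[(s + e 0).+2]addn1 natrD.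
have : 0 < (s + e 0).+1%:R :> R by rewrite ltr0n.
move: ((s + e 0).+1%:R : R) => t t0 xt.
rewrite ler_pdivlMr//; have : t / (t + 1) = 1 - (t + 1)^-1 by field; apply/eqP; lra.
by rewrite mulrC => ->; lra.
Qed.

Lemma pierce_inj s : injective (pierce s).
Proof.
move=> e e' ee'; apply/funext => k.
elim: k s e e' ee' => [|k IH] s e e' ee'.
  by case: (ltngtP (e 0) (e' 0)) => // /(pierce_head s); rewrite ee' ltxx.
have h0 : e 0 = e' 0.
  by case: (ltngtP (e 0) (e' 0)) => // /(pierce_head s); rewrite ee' ltxx.
apply: (IH (s + e 0).+1 (shiftn1 e) (shiftn1 e')).
move: ee'; rewrite (pierceE s e) (pierceE s e') -h0 => /divIf.
by rewrite pnatr_eq0 => /(_ isT)/(congr1 (fun x => 1 - x)); rewrite !subKr.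
Qed.

(** With [v] the first denominator for shift [s], the constant 3 comes from [1 / v <= 2 / (v + 1)]
    and from the tail for shift [s + 1] being at most 1/3. *)
Lemma pierce_succ_bounds s e : pierce s.+1 e <= pierce s e <= 3 * pierce s.+1 e.
Proof.
rewrite (pierceE s e) (pierceE s.+1 e) addSn.
have := pierce_ge0 (s + e 0).+1 (shiftn1 e); have := pierce_le (s + e 0).+1 (shiftn1 e).
have := pierce_ge0 (s + e 0).+2 (shiftn1 e); have := pierce_le (s + e 0).+2 (shiftn1 e).
move: (pierce _ _) (pierce _ _) => z z'.
rewrite -[(s + e 0).+3]addn1 -[(s + e 0).+2]addn1 !natrD.
have : 1 <= (s + e 0).+1%:R :> R by rewrite ler1n.
move: ((s + e 0).+1%:R : R) => v v1.
move=> hz' z'0 hz z0.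
have {}hz' : z' * (v + 1 + 1) <= 1 by rewrite -ler_pdivlMr ?mul1r//; lra.
have {}hz : z * (v + 1) <= 1 by rewrite -ler_pdivlMr ?mul1r//; lra.
apply/andP; split.
  rewrite ler_pdivrMr; last by lra.
  rewrite mulrAC ler_pdivlMr; last by lra.
  nra.
rewrite ler_pdivrMr; last by lra.
have -> : 3 * ((1 - z') / (v + 1)) * v = (3 * (1 - z') * v) / (v + 1) by ring.
rewrite ler_pdivlMr; last by lra.
have : z' * 3 <= 1 by nra.
nra.
Qed.

(** With first denominator [v] and tail [z], the gap is [(1 / (s + 1) - 1 / v) + z / v]; these
    nonnegative terms change by factors at most 4 and 2 * 3. *)
Lemma gap_succ_bounds s e :
  s.+2%:R^-1 - pierce s.+1 e <= s.+1%:R^-1 - pierce s e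
    <= 6 * (s.+2%:R^-1 - pierce s.+1 e).
Proof.
rewrite (pierceE s e) (pierceE s.+1 e) addSn.
have /andP[h1 h2] := pierce_succ_bounds (s + e 0).+1 (shiftn1 e).
have h0 := pierce_ge0 (s + e 0).+2 (shiftn1 e).
move: (pierce _ _) (pierce _ _) h0 h1 h2 => z z' z'0 z'z zz'.
have s1 : 1 <= s.+1%:R :> R by rewrite ler1n.
have sv : s.+1%:R <= (s + e 0).+1%:R :> R by rewrite ler_nat ltnS leq_addr.
rewrite -[(s + e 0).+2]addn1 -[s.+2]addn1 !natrD.
move: (s.+1%:R : R) ((s + e 0).+1%:R : R) s1 sv => a v a1 av.
have [d0 d1 d2] := inv_sub_succ_bounds a1 av.
have /andP[z1 z2] := div_succ_bounds (le_trans a1 av) z'0 z'z zz'.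
have z3 : 0 <= z' / (v + 1) by apply: divr_ge0; lra.
rewrite !mulrBl !mul1r.
move: (a^-1) (v^-1) ((a + 1)^-1) ((v + 1)^-1) (z / v) (z' / (v + 1)) d0 d1 d2 z1 z2 z3.
by move=> *; apply/andP; split; lra.
Qed.

(** For first denominators [t < u], the difference is [1 / (t + 1) - 1 / u], plus the gap of the
    tail of [e] over [t], plus the tail of [e'] over [u]. The factors are 4, 2 * 6 and 2 * 3. *)
Lemma head_diff_succ_bounds s e e' : (e 0 < e' 0)%N ->
  pierce s.+1 e - pierce s.+1 e' <= pierce s e - pierce s e'
    <= 12 * (pierce s.+1 e - pierce s.+1 e').
Proof.
move=> ee'; rewrite (pierceE s e) (pierceE s.+1 e) (pierceE s e') (pierceE s.+1 e') !addSn.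
have /andP[h1 h2] := pierce_succ_bounds (s + e' 0).+1 (shiftn1 e').
have h0 := pierce_ge0 (s + e' 0).+2 (shiftn1 e').
have /andP[g1 g2] := gap_succ_bounds (s + e 0).+1 (shiftn1 e).
have g0 := pierce_le (s + e 0).+2 (shiftn1 e).
have t1 : 1 <= (s + e 0).+1%:R :> R by rewrite ler1n.
have tu : (s + e 0).+1%:R + 1 <= (s + e' 0).+1%:R :> R.
  by rewrite natr1 ler_nat ltnS -addnS leq_add2l.
move: (pierce _ _) (pierce _ _) h0 h1 h2 => y y' y'0 y'y yy'.
move: (pierce _ _) (pierce _ _) g0 g1 g2 => x x'.
rewrite -[(s + e 0).+3]addn1 -[(s + e 0).+2]addn1 -[(s + e' 0).+2]addn1 !natrD.
move: ((s + e 0).+1%:R : R) ((s + e' 0).+1%:R : R) t1 tu => t u t1 tu g0 g1 g2.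
have u1 : 1 <= u by lra.
have t2 : 1 <= t + 1 by lra.
have gap0 : 0 <= (t + 1 + 1)^-1 - x' by lra.
have [d0 d1 d2] := inv_sub_succ_bounds t2 tu.
have /andP[z1 z2] := div_succ_bounds u1 y'0 y'y yy'.
have /andP[w1 w2] := div_succ_bounds t1 gap0 g1 g2.
have z3 : 0 <= y' / (u + 1) by apply: divr_ge0; lra.
have w3 : 0 <= ((t + 1 + 1)^-1 - x') / (t + 1) by apply: divr_ge0; lra.
have -> : (1 - x) / t = (t + 1)^-1 + ((t + 1)^-1 - x) / t.
  by field; do ?[apply/andP; split]; apply/eqP; lra.
have -> : (1 - x') / (t + 1) = (t + 1 + 1)^-1 + ((t + 1 + 1)^-1 - x') / (t + 1).
  by field; do ?[apply/andP; split]; apply/eqP; lra.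
rewrite ![(1 - _) * _]mulrBl !mul1r.
move: (((t + 1)^-1 - x) / t) (((t + 1 + 1)^-1 - x') / (t + 1)) w1 w2 w3.
move: (y / u) (y' / (u + 1)) z1 z2 z3.
move: ((t + 1)^-1) ((t + 1 + 1)^-1) (u^-1) ((u + 1)^-1) d0 d1 d2.
by move=> *; apply/andP; split; lra.
Qed.

(** Raising the shift by one turns each denominator [q] into [q + 1], so this product of
    [(q + 1) / q] is the ratio of the absolute slopes of the prefix maps for [s] and [s + 1]. *)
Fixpoint pierce_weight k s e : R :=
  if k is k'.+1
  then (1 + (s + e 0).+1%:R^-1) * pierce_weight k' (s + e 0).+1 (shiftn1 e) else 1.

Lemma pierce_weight_ge1 k s e : 1 <= pierce_weight k s e.
Proof.
elim: k s e => [//|k IH] s e /=.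
have h := IH (s + e 0).+1 (shiftn1 e).
by rewrite (le_trans h)// ler_peMl ?(le_trans ler01 h)// lerDl invr_ge0 ler0n.
Qed.

(** The common prefix scales the two distances by products of [1 / q] and of [1 / (q + 1)], which
    produces the weight; the first differing entry produces the 12. *)
Lemma first_diff_succ_bounds k s e e' :
  (forall i, (i < k)%N -> e i = e' i) -> e k <> e' k ->
  `|pierce s.+1 e - pierce s.+1 e'| <= `|pierce s e - pierce s e'|
    <= 12 * pierce_weight k s e * `|pierce s.+1 e - pierce s.+1 e'|.
Proof.
elim: k s e e' => [|k IH] s e e' ee' neq.
  rewrite mulr1.
  wlog lt_ee' : e e' {ee' neq} / (e 0 < e' 0)%N.
    move=> H; case: (ltngtP (e 0) (e' 0)) neq => // lt_ee' _; first exact: H.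
    rewrite (distrC (pierce s.+1 e)) (distrC (pierce s e)); exact: H.
  have D0 := pierce_head s lt_ee'; have D1 := pierce_head s.+1 lt_ee'.
  have := head_diff_succ_bounds s lt_ee'.
  by rewrite !gtr0_norm ?subr_gt0.
rewrite (pierceE s e) (pierceE s.+1 e) (pierceE s e') (pierceE s.+1 e') !addSn -ee'//.
rewrite !dist_sub_div /= ee'//.
have ee1' i : (i < k)%N -> shiftn1 e i = shiftn1 e' i by move=> ik; exact: ee'.
have /andP[] := IH (s + e' 0).+1 _ _ ee1' neq.
have := normr_ge0 (pierce (s + e' 0).+2 (shiftn1 e) - pierce (s + e' 0).+2 (shiftn1 e')).
move: `|_| `|_| => A A'.
have := pierce_weight_ge1 k (s + e' 0).+1 (shiftn1 e).
move: (pierce_weight _ _ _) => W W1.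
rewrite -[(s + e' 0).+2]addn1 natrD.
have : 0 < (s + e' 0).+1%:R :> R by rewrite ltr0n.
move: ((s + e' 0).+1%:R : R) => t t0 A'0 A'A AA'; apply/andP; split.
  rewrite ler_pdivrMr; last by lra.
  rewrite mulrAC ler_pdivlMr; last by lra.
  nra.
have -> : 12 * ((1 + t^-1) * W) * (A' / (t + 1)) = 12 * W * A' / t.
  by field; apply/andP; split; apply/eqP; lra.
by rewrite ler_pM2r// invr_gt0.
Qed.

End pierce.

(** * Null sets and changes of prefix *)

Lemma ereal_eq0_le_inv_nat (R : realType) (c : R) (x : \bar R) : (0 <= x)%E ->
  (forall n : nat, (x <= (c / n.+1%:R)%:E)%E) -> x = 0%E.
Proof.
move=> x0 xc; case: x x0 xc => [r| |] //; last by move=> _ /(_ 0%N); rewrite leye_eq.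
rewrite lee_fin => r0 rc; congr (_%:E); apply/eqP; rewrite eq_le r0 andbT leNgt.
apply/negP => r_gt0; have := rc (Num.truncn (c / r)).
rewrite lee_fin ler_pdivlMr ?ltr0n// mulrC -ler_pdivlMr// leNgt.
by rewrite truncnS_gt.
Qed.

Section lebesgue_null.
Context (R : realType).
Implicit Types (N : set R).

Definition lebesgue_null : set (set R) :=
  [set N | measurable N /\ lebesgue_measure N = 0%E].

Lemma lebesgue_null_bigcup (N : nat -> set R) :
  (forall k, lebesgue_null (N k)) -> lebesgue_null (\bigcup_k N k).
Proof.
move=> nN; have mN : measurable (\bigcup_k N k).
  by apply: bigcupT_measurable => k; have [] := nN k.
split=> //; apply/eqP; rewrite eq_le measure_ge0 andbT.
apply: (le_trans (measure_sigma_subadditive lebesgue_measure (F := N) _ mN _)) => //.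
  by move=> k; have [] := nN k.
by rewrite eseries0// => k _ _; have [] := nN k.
Qed.

Lemma lebesgue_null_interval_cover N (eps : R) : lebesgue_null N -> 0 < eps ->
  exists a b : nat -> R, [/\ forall k, a k <= b k,
    N `<=` \bigcup_k `]a k, b k]%classic &
    (\sum_(k <oo) (b k - a k)%:E <= eps%:E)%E].
Proof.
move=> [mN N0] eps0.
(* Lebesgue measure unfolds to an infimum over countable covers by half-open intervals. *)
have /ereal_inf_lt[z [/= F [mF NF] Fz zeps]] : (lebesgue_measure N < eps%:E)%E.
  by rewrite N0 lte_fin.
have /choice[ab abP] : forall k, exists ab : R * R, ab.1 <= ab.2 /\ F k = `]ab.1, ab.2]%classic.
  move=> k; have /ocitvP[->|[ab lt_ab ->]] : ocitv (F k) by exact: mF.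
    by exists (0, 0); rewrite set_itvoc0.
  by exists ab; split=> //; exact: ltW.
exists (fun k => (ab k).1), (fun k => (ab k).2); split.
- by move=> k; have [] := abP k.
- by move=> x /NF[k _ Fkx]; exists k => //; have [_ <-] := abP k.
- move: zeps => /ltW; rewrite -Fz; apply: le_trans; rewrite le_eqVlt; apply/orP; left.
  apply/eqP; apply: eq_eseriesr => k _; have [ab_le ->] := abP k.
  by rewrite wlength_itv_bnd.
Qed.

(** A covering interval of length [r] containing some [g i0] is replaced by the interval of radius
    [C r] about [h i0]. Indexing by [I] allows the comparison to hold on the part [A] alone. *)
Lemma lipschitz_lebesgue_null (I : Type) (A : set I) (g h : I -> R) (C : R) N :
  (forall i j, A i -> A j -> `|h i - h j| <= C * `|g i - g j|) ->
  lebesgue_null N ->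
  exists2 N', lebesgue_null N' & forall i, A i -> N (g i) -> N' (h i).
Proof.
move=> lip nN.
wlog C0 : C lip / 0 <= C.
  move=> H; apply: (H `|C|) => // i j Ai Aj.
  by rewrite (le_trans (lip _ _ Ai Aj))// ler_wpM2r// ler_norm.
have cov (eps : R) : 0 < eps -> exists V : set R, [/\ measurable V,
    (lebesgue_measure V <= (2 * C * eps)%:E)%E & forall i, A i -> N (g i) -> V (h i)].
  move=> eps0; have [a [b [ab Nab sab]]] := lebesgue_null_interval_cover nN eps0.
  have /choice[J JP] : forall k, exists J : set R, [/\ measurable J,
      (lebesgue_measure J <= (2 * C)%:E * (b k - a k)%:E)%E &
      forall i, A i -> `]a k, b k]%classic (g i) -> J (h i)].
    move=> k; have [[i0 [Ai0 gi0]]|none] :=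
        pselect (exists i, A i /\ `]a k, b k]%classic (g i)); last first.
      exists set0; split=> //; last by move=> i Ai gi; apply: none; exists i.
      by rewrite measure0 lee_fin mulr_ge0 ?mulr_ge0// subr_ge0.
    exists `[h i0 - C * (b k - a k), h i0 + C * (b k - a k)]%classic; split=> //.
      rewrite lebesgue_measure_itv/= lte_fin; case: ifPn => _.
        by rewrite lee_fin; lra.
      by rewrite lee_fin mulr_ge0 ?mulr_ge0// subr_ge0.
    move=> i Ai gi; rewrite /= in_itv/= -ler_distl.
    apply: (le_trans (lip _ _ Ai Ai0)); rewrite ler_wpM2l//.
    move: gi0 gi; rewrite /= !in_itv/= => /andP[? ?] /andP[? ?].
    by rewrite ler_distl; apply/andP; split; lra.
  have mJ : measurable (\bigcup_k J k).
    by apply: bigcupT_measurable => k; have [] := JP k.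
  exists (\bigcup_k J k); split=> //.
  - apply: (le_trans (measure_sigma_subadditive lebesgue_measure (F := J) _ mJ _)) => //.
      by move=> k; have [] := JP k.
    rewrite (@le_trans _ _ (\sum_(k <oo) ((2 * C)%:E * (b k - a k)%:E))%E)//.
      by apply: lee_nneseries => k *; [exact: measure_ge0|have [] := JP k].
    rewrite nneseriesZl; last by move=> k _; rewrite lee_fin subr_ge0.
    by rewrite [leRHS]EFinM lee_wpmul2l// lee_fin mulr_ge0.
  - by move=> i Ai /Nab[k _ gi]; exists k => //; have [_ _] := JP k; exact.
have /choice[V VP] : forall n : nat, exists V : set R, [/\ measurable V,
    (lebesgue_measure V <= (2 * C / n.+1%:R)%:E)%E & forall i, A i -> N (g i) -> V (h i)].
  by move=> n; apply: cov; rewrite invr_gt0.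
(* The intersection is measurable, with measure at most [2 C / (n + 1)] for every [n]. *)
exists (\bigcap_n V n); last by move=> i Ai gi n _; have [_ _] := VP n; exact.
have mV : measurable (\bigcap_n V n).
  by apply: bigcapT_measurable => n; have [] := VP n.
split=> //; apply: (@ereal_eq0_le_inv_nat _ (2 * C)) => [|n]; first exact: measure_ge0.
have [mVn Vn _] := VP n; apply: le_trans Vn.
by apply: le_measure; rewrite ?inE//; exact: bigcap_inf.
Qed.

End lebesgue_null.

(** * Measure of the values of large weight *)

Section unbounded_weight.
Context (R : realType).
Implicit Types (s n k : nat) (M : R).

Lemma measurable_affine (t : R) : measurable_fun setT (fun x : R => 1 - t * x).
Proof. by apply: measurable_funB => //; exact: measurable_funM. Qed.

(** The image of [t] times Lebesgue measure under the affine map agrees with Lebesgue measure on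
    half-open intervals, hence everywhere by uniqueness. *)
Lemma lebesgue_measure_affine (t : R) (A : set R) : 0 < t -> measurable A ->
  lebesgue_measure ((fun x => 1 - t * x) @^-1` A) = (t^-1%:E * lebesgue_measure A)%E.
Proof.
move=> t0 mA; pose f : measurableTypeR R -> measurableTypeR R := fun x => 1 - t * x.
have mf : measurable_fun setT f by exact: measurable_affine.
have : lebesgue_measure A = pushforward (mscale (NngNum (ltW t0)) lebesgue_measure) f A.
  apply: lebesgue_measure_unique => //= _ [[a b] _ <-].
  rewrite /pushforward /mscale/=.
  rewrite (_ : f @^-1` _ = `[(1 - b) / t, (1 - a) / t[%classic); last first.
    apply/seteqP; split => x /=; rewrite !in_itv/= /f ler_pdivrMr// ltr_pdivlMr//;
      by move=> /andP[? ?]; apply/andP; split; lra.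
  rewrite !lebesgue_measure_itv/= !lte_fin ltr_pM2r ?invr_gt0// ltrD2l ltrN2.
  case: ifPn => _; last by rewrite mule0.
  rewrite -!EFinD -EFinM; congr (_%:E); field; apply/eqP; lra.
by rewrite /pushforward /mscale/= => ->; rewrite muleA -EFinM mulVf ?gt_eqF// mul1e.
Qed.

(* [heavy n s M] contains the values of [pierce s] whose weight reaches [M]
   within the first [n] denominators. *)
Fixpoint heavy n s M : set R :=
  if M <= 1 then `[0, s.+1%:R^-1]%classic
  else if n is n'.+1 then
    \bigcup_i (fun x : R => 1 - (s + i).+1%:R * x) @^-1`
      heavy n' (s + i).+1 (M / (1 + (s + i).+1%:R^-1))
  else set0.

Lemma measurable_heavy n s M : measurable (heavy n s M).
Proof.
elim: n s M => [|n IH] s M /=; case: ifP => // _.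
apply: bigcupT_measurable => i; rewrite -[X in measurable X]setTI.
by apply: measurable_affine => //; exact: IH.
Qed.

Lemma heavyS n s M : heavy n s M `<=` heavy n.+1 s M.
Proof.
elim: n s M => [|n IH] s M; first by rewrite /=; case: ifP => _ x.
rewrite [heavy n.+1 _ _]/= [heavy n.+2 _ _]/=; case: ifP => _ //.
by apply: subset_bigcup => i _ x; exact: IH.
Qed.

Lemma pierce_heavy n s M e : M <= pierce_weight R n s e -> heavy n s M (pierce R s e).
Proof.
elim: n s M e => [|n IH] s M e /= hM; case: ifPn => M1.
- by rewrite /= in_itv/= pierce_ge0 pierce_le.
- by rewrite hM in M1.
- by rewrite /= in_itv/= pierce_ge0 pierce_le.
- exists (e 0%N) => //=.
  rewrite (pierceE _ s) mulrCA divff ?pnatr_eq0// mulr1 subKr.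
  by apply: IH; rewrite ler_pdivrMr ?addr_gt0 ?invr_gt0// mulrC.
Qed.

(* Chosen so that [V (t - 1) >= V t + (1 + 1/t) * V t / t]: summing the bounds over
   the possible first denominators [t > s] then telescopes. *)
Definition weight_bound s : R := (s%:R + 3) / (s%:R + 1) ^+ 2.

Lemma weight_bound_step s :
  s.+1%:R^-1 * ((1 + s.+1%:R^-1) * weight_bound s.+1) <= weight_bound s - weight_bound s.+1.
Proof.
rewrite /weight_bound -natr1; have : 0 <= s%:R :> R by rewrite ler0n.
move: (s%:R : R) => x x0.
rewrite -subr_ge0.
have -> : (x + 3) / (x + 1) ^+ 2 - (x + 1 + 3) / (x + 1 + 1) ^+ 2
    - (x + 1)^-1 * ((1 + (x + 1)^-1) * ((x + 1 + 3) / (x + 1 + 1) ^+ 2))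
  = x / ((x + 1) ^+ 2 * (x + 2) ^+ 2).
  by field; do ?[apply/andP; split]; apply/eqP; lra.
by rewrite divr_ge0// mulr_ge0// exprn_ge0//; lra.
Qed.

Lemma weight_bound_ge s : s.+1%:R^-1 <= weight_bound s.
Proof.
rewrite /weight_bound -natr1; have : 0 <= s%:R :> R by rewrite ler0n.
move: (s%:R : R) => x x0.
rewrite ler_pdivlMr ?exprn_gt0//; last by lra.
rewrite expr2 mulrA mulVf; last by apply/eqP; lra.
by lra.
Qed.

Lemma weight_bound_ge0 s : 0 <= weight_bound s.
Proof. by rewrite (le_trans _ (weight_bound_ge s))// invr_ge0. Qed.

(** Write [V] for [weight_bound]. The piece with first denominator [t] has [1 / t] times the measure
    of a heavy set with threshold [M / (1 + 1 / t)]. By induction and [weight_bound_step] this is at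
    most [(V (t - 1) - V t) / M], and the sum telescopes. *)
Lemma lebesgue_measure_heavy n s M : 0 < M ->
  (lebesgue_measure (heavy n s M) <= (weight_bound s / M)%:E)%E.
Proof.
have base m (K : R) : 0 < K -> K <= 1 ->
    (lebesgue_measure (`[0%R, (m.+1%:R^-1)%R]%classic : set R) <= (weight_bound m / K)%:E)%E.
  move=> K0 K1; rewrite lebesgue_measure_itv/= lte_fin invr_gt0 ltr0n/= sube0 lee_fin.
  rewrite (le_trans (weight_bound_ge _))// ler_peMr ?weight_bound_ge0//.
  by rewrite invf_ge1.
elim: n s M => [|n IH] s M M0 /=; case: ifPn => M1; do ?exact: base.
  by rewrite measure0 lee_fin divr_ge0 ?weight_bound_ge0// ltW.
set F := fun i : nat => _ @^-1` _.
have mF i : measurable (F i).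
  rewrite /F -[X in measurable X]setTI.
  by apply: measurable_affine => //; exact: measurable_heavy.
apply: (le_trans (measure_sigma_subadditive lebesgue_measure mF (bigcupT_measurable _ mF)
  (@subset_refl _ _))).
have Fi i : (lebesgue_measure (F i) <=
    ((weight_bound (s + i) - weight_bound (s + i).+1) / M)%:E)%E.
  rewrite /F lebesgue_measure_affine ?ltr0n//; last exact: measurable_heavy.
  have t0 : 0 < 1 + (s + i).+1%:R^-1 :> R by rewrite addr_gt0 ?invr_gt0.
  apply: (@le_trans _ _ ((s + i).+1%:R^-1%:E *
      (weight_bound (s + i).+1 / (M / (1 + (s + i).+1%:R^-1)))%:E)%E).
    by rewrite lee_wpmul2l ?lee_fin//; apply: IH; rewrite divr_gt0.
  have := weight_bound_step (s + i).
  move: (weight_bound (s + i)) (weight_bound (s + i).+1) => V V' VV'.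
  rewrite -EFinM lee_fin invf_div !mulrA ler_wpM2r ?invr_ge0 ?(ltW M0)//.
  by rewrite -mulrA (mulrC V').
apply: lime_le; first by apply: is_cvg_nneseries => *; exact: measure_ge0.
apply: nearW => m; apply: (le_trans (lee_sum _ (fun i _ => Fi i))).
rewrite sumEFin lee_fin -mulr_suml ler_pM2r ?invr_gt0//.
rewrite (telescope_sumr_eq (fun i => - weight_bound (s + i)))//; last first.
  by move=> i _; rewrite addnS; ring.
by rewrite opprK addn0 addrC lerBlDr lerDl weight_bound_ge0.
Qed.

Lemma unbounded_weight_null s : exists2 N : set R, lebesgue_null N &
  forall e, (forall M, exists n, M <= pierce_weight R n s e) -> N (pierce R s e).
Proof.
pose H k := \bigcup_n heavy n s k.+1%:R.
have mH k : measurable (H k) by apply: bigcupT_measurable => n; exact: measurable_heavy.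
have mHk : measurable (\bigcap_k H k) by exact: bigcapT_measurable.
exists (\bigcap_k H k); last first.
  by move=> e he k _; have [n hn] := he k.+1%:R; exists n => //; exact: pierce_heavy.
split=> //; apply: (@ereal_eq0_le_inv_nat _ (weight_bound s)) => [|k]; first exact: measure_ge0.
apply: (@le_trans _ _ (lebesgue_measure (H k))).
  by apply: le_measure; rewrite ?inE; [exact: mHk|exact: mH|exact: bigcap_inf].
(* The heavy sets increase with [n], so the bound uniform in [n] passes to their union. *)
have cH := nondecreasing_cvg_mu (mu := lebesgue_measure)
  (fun n => measurable_heavy n s k.+1%:R) (mH k).
rewrite -(cvg_lim _ (cH _))//; last first.
  by apply/nondecreasing_seqP => n; apply/subsetPset; exact: heavyS.
apply: lime_le; first by apply/cvg_ex; exists (lebesgue_measure (H k)); apply: cH;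
  apply/nondecreasing_seqP => n; apply/subsetPset; exact: heavyS.
by apply: nearW => n; exact: lebesgue_measure_heavy.
Qed.

End unbounded_weight.

(** The entries of [e] below [n] are overwritten, so a function of [splice n a e] depends only on
    the entries from [n] on. *)
Definition splice n (a e : nat -> nat) : nat -> nat := fun i => if (i < n)%N then a i else e i.

(** * Transport of ideals under changes of shift and prefix *)

Section transport.
Context (R : realType).
Implicit Types (s n k : nat) (e : nat -> nat) (N : set R) (I : set (set R)).

Lemma first_diff e e' : e <> e' ->
  exists2 k, (forall i, (i < k)%N -> e i = e' i) & e k <> e' k.
Proof.
move=> ee'; have dif : exists k, e k != e' k.
  by apply: contrapT => /forallNP h; apply: ee'; apply/funext => k; apply/eqP/negPn/negP/h.
case: (ex_minnP dif) => k /eqP ek kmin; exists k => // i ik.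
by apply/eqP/negPn/negP => /kmin; rewrite leqNgt ik.
Qed.

Lemma pierce_succ_lebesgue_null s N : lebesgue_null N ->
  exists2 N', lebesgue_null N' & forall e, N (pierce R s e) -> N' (pierce R s.+1 e).
Proof.
have lip e e' : setT e -> setT e' ->
    `|pierce R s.+1 e - pierce R s.+1 e'| <= 1 * `|pierce R s e - pierce R s e'|.
  have [->|/first_diff[k ee' nee']] := pselect (e = e'); first by rewrite !subrr normr0 mulr0.
  by rewrite mul1r; have /andP[] := first_diff_succ_bounds R s ee' nee'.
by move=> /(lipschitz_lebesgue_null lip)[N' nN' NN']; exists N' => // e; exact: NN'.
Qed.

(** Sequences with weights bounded by some [m] are handled piecewise, with Lipschitz constant
    [12 m]; the null set of unbounded weights is added as member 0 of the union. *)
Lemma pierce_pred_lebesgue_null s N : lebesgue_null N ->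
  exists2 N', lebesgue_null N' & forall e, N (pierce R s.+1 e) -> N' (pierce R s e).
Proof.
move=> nN; have [B nB bad] := unbounded_weight_null R s.
pose A m := [set e | forall k, pierce_weight R k s e <= m%:R].
have lip m e e' : A m e -> A m e' ->
    `|pierce R s e - pierce R s e'| <= 12 * m%:R * `|pierce R s.+1 e - pierce R s.+1 e'|.
  move=> Ae _; have [->|/first_diff[k ee' nee']] := pselect (e = e').
    by rewrite !subrr normr0 mulr0.
  have /andP[_ /le_trans] := first_diff_succ_bounds R s ee' nee'; apply.
  by rewrite ler_wpM2r// ler_wpM2l.
have /choice[F FP] : forall m, exists F, lebesgue_null F /\
    forall e, A m e -> N (pierce R s.+1 e) -> F (pierce R s e).
  by move=> m; have [F nF NF] := lipschitz_lebesgue_null (lip m) nN; exists F.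
exists (\bigcup_k (if k is m.+1 then F m else B)).
  by apply: lebesgue_null_bigcup => -[//|m]; have [] := FP m.
move=> e Ne; have [[m Am]|nA] := pselect (exists m, A m e).
  by exists m.+1 => //; have [_] := FP m; exact.
exists 0%N => //; apply: bad => M; apply: contrapT => /forallNP h.
apply: nA; exists (Num.truncn M).+1 => k.
by rewrite (le_trans _ (ltW (truncnS_gt _)))// leNgt; apply/negP => /ltW; exact: h.
Qed.

(** Any two shifts are joined by stepping down to 0 and then up. *)
Lemma pierce_shift_lebesgue_null s s' N : lebesgue_null N ->
  exists2 N', lebesgue_null N' & forall e, N (pierce R s e) -> N' (pierce R s' e).
Proof.
move=> nN; have [N0 nN0 NN0] : exists2 N', lebesgue_null N' &
    forall e, N (pierce R s e) -> N' (pierce R 0 e).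
  elim: s N nN => [|s IH] N nN; first by exists N.
  have [N1 /IH[N2 nN2 h2] h1] := pierce_pred_lebesgue_null s nN.
  by exists N2 => // e /h1/h2.
elim: s' => [|s' [N1 nN1 h1]]; first by exists N0.
have [N2 nN2 h2] := pierce_succ_lebesgue_null s' nN1.
by exists N2 => // e /h1/h2.
Qed.

(** Induction on [n]: [pull] removes the head of [a], the induction hypothesis changes the rest of
    the prefix, [push] adds the head of [b], and [shift] settles [n = 0]. *)
Lemma splice_transport I :
  (forall s s' N, I N -> exists2 N', I N' &
     forall e, N (pierce R s e) -> N' (pierce R s' e)) ->
  (forall t N, I N -> exists2 N', I N' & forall x, N ((1 - x) / t.+1%:R) -> N' x) ->
  (forall t N, I N -> exists2 N', I N' & forall x, N x -> N' ((1 - x) / t.+1%:R)) ->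
  forall n a b s s' N, I N -> exists2 N', I N' &
    forall e, N (pierce R s (splice n a e)) -> N' (pierce R s' (splice n b e)).
Proof.
move=> shift pull push; elim=> [|n IH] a b s s' N IN.
  by have [N' IN' NN'] := shift s s' _ IN; exists N'.
have spliceS c e : shiftn1 (splice n.+1 c e) = splice n (shiftn1 c) (shiftn1 e).
  by apply/funext => i.
have [N1 /(IH (shiftn1 a) (shiftn1 b) (s + a 0%N).+1 (s' + b 0%N).+1)[N2 IN2 h2] h1] :=
  pull (s + a 0%N) _ IN.
have [N3 IN3 h3] := push (s' + b 0%N)%N _ IN2.
exists N3 => // e; rewrite (pierceE _ s) (pierceE _ s') !spliceS => /h1/h2.
exact: h3.
Qed.

Lemma splice_lebesgue_null n a b N : lebesgue_null N ->
  exists2 N', lebesgue_null N' &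
    forall e, N (pierce R 0 (splice n a e)) -> N' (pierce R 0 (splice n b e)).
Proof.
apply: splice_transport => [|t {}N nN|t {}N nN]; first exact: pierce_shift_lebesgue_null.
- have lip x y : setT x -> setT y ->
      `|id x - id y| <= t.+1%:R * `|(1 - x) / t.+1%:R - (1 - y) / t.+1%:R| :> R.
    by rewrite dist_sub_div mulrC divfK ?pnatr_eq0.
  by have [N' nN' NN'] := lipschitz_lebesgue_null lip nN; exists N' => // x; exact: NN'.
- have lip x y : setT x -> setT y ->
      `|(1 - x) / t.+1%:R - (1 - y) / t.+1%:R| <= t.+1%:R^-1 * `|id x - id y| :> R.
    by rewrite dist_sub_div mulrC.
  by have [N' nN' NN'] := lipschitz_lebesgue_null lip nN; exists N' => // x; exact: NN'.
Qed.

Lemma splice_countable n a b N : countable N ->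
  exists2 N', countable N' &
    forall e, N (pierce R 0 (splice n a e)) -> N' (pierce R 0 (splice n b e)).
Proof.
apply: splice_transport => [s s' {}N cN|t {}N cN|t {}N cN].
(* The preimage is countable because [pierce R s] is injective. *)
- exists (pierce R s' @` (pierce R s @^-1` N)); last by move=> e Ne; exists e.
  apply: sub_countable (card_image_le _ _) _; apply: sub_countable cN.
  by apply: card_ge_preimage => e e' _ _; exact: pierce_inj.
- exists ((fun x => 1 - t.+1%:R * x) @` N); first exact: sub_countable (card_image_le _ _) cN.
  move=> x Nx; exists ((1 - x) / t.+1%:R) => //.
  by rewrite mulrC divfK ?pnatr_eq0// subKr.
- exists ((fun x => (1 - x) / t.+1%:R) @` N); first exact: sub_countable (card_image_le _ _) cN.
  by move=> x Nx; exists x.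
Qed.

End transport.

(** The closed form serves both measurability and the comparison with the random series. *)
Lemma pierce_partE (R : realType) n s (e : nat -> nat) : pierce_part R n s e =
  \sum_(k < n) (-1) ^+ k / \prod_(j < k.+1) (s%:R + \sum_(i < j.+1) (e i).+1%:R).
Proof.
elim: n s e => [|n IH] s e; first by rewrite big_ord0.
rewrite /= IH big_ord_recl expr0 big_ord1 big_ord1 -natrD addnS mulrBl; congr (_ + _).
rewrite mulr_suml -sumrN; apply: eq_bigr => k _ /=.
rewrite /bump /= add1n exprS mulN1r mulNr [X in _ = - (_ / X)]big_ord_recl.
rewrite big_ord1 -natrD addnS invfM mulrA mulrAC.
congr (- (_ / _ / _)). apply: eq_bigr => j _.
by rewrite [in RHS]big_ord_recl addrA -natrD addnS.
Qed.

(** * Zero-one law *)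

Section zero_one.
Context d (T : measurableType d) (R : realType) (P : probability T R).
Variable Z : nat -> T -> nat.
Hypothesis measurable_Z : forall k B, measurable (Z k @^-1` B).

Definition box n l (A : nat -> set nat) : set T :=
  [set w | forall i, (n <= i < l)%N -> A i (Z i w)].

Hypothesis indep_Z : forall n l A,
  P (box n l A) = (\prod_(n <= i < l) P (Z i @^-1` A i))%E.

(** A pi-system generating the sigma-algebra of the entries [Z i] with [n <= i]. *)
Definition boxes n : set (set T) := [set E | exists l A, E = box n l A].

Lemma measurable_box n l A : measurable (box n l A).
Proof.
rewrite (_ : box n l A = \bigcap_(i in [set i | n <= i < l]%N) (Z i @^-1` A i)).
  by apply: bigcap_measurableType => i _; exact: measurable_Z.
by apply/seteqP; split.
Qed.

Lemma setI_closed_boxes n : setI_closed (boxes n).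
Proof.
move=> _ _ [l [A ->]] [l' [A' ->]].
exists (maxn l l'), (fun i => [set m | ((i < l)%N -> A i m) /\ ((i < l')%N -> A' i m)]).
apply/seteqP; split => [w [h h'] i /andP[ni _]|w h].
  by split=> il; [apply: h|apply: h']; rewrite ni.
split=> i /andP[ni il].
  by have [|+ _] := h i; [rewrite ni leq_max il|exact].
by have [|_] := h i; [rewrite ni leq_max il orbT|exact].
Qed.

Lemma boxes_setT n : boxes n setT.
Proof. by exists 0%N, (fun=> setT); apply/seteqP; split. Qed.

Lemma indep_sigma_boxes n C (c : R) : measurable C ->
  (forall E, boxes n E -> P (C `&` E) = (c%:E * P E)%E) ->
  forall E, <<s boxes n >> E -> P (C `&` E) = (c%:E * P E)%E.
Proof.
move=> mC hC E sE.
have PC : P C = c%:E by rewrite -[C]setIT hC ?probability_setT ?mule1//; exact: boxes_setT.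
suff : measurable E /\ P (C `&` E) = (c%:E * P E)%E by case.
apply: (lambda_system_subset (@setI_closed_boxes n) (D := setT)
  (H := [set E | measurable E /\ P (C `&` E) = (c%:E * P E)%E])) => //; last first.
- by move=> _ [l [A ->]]; split; [exact: measurable_box|apply: hC; exists l, A].
apply/dynkin_lambda_system; split.
- by split=> //; apply: hC; exact: boxes_setT.
- move=> A [mA hA]; split; first exact: measurableC.
  have -> : P (C `&` ~` A) = (c%:E - c%:E * P A)%E.
    transitivity (P C - P (C `&` A))%E; last by rewrite PC hA.
    by rewrite -setDE; apply: measureD => //; have := ltry c; rewrite -PC.
  by rewrite probability_setC// muleBr// ?mule1//.
- move=> F tF hF; have mF k : measurable (F k) by have [] := hF k.
  split; first exact: bigcupT_measurable.
  rewrite setI_bigcupr measure_bigcup//; last 2 first.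
  + by move=> k _; exact: measurableI.
  + exact: trivIset_setIl.
  rewrite measure_bigcup// -nneseriesZl//.
  by apply: eq_eseriesr => k _; have [] := hF k.
Qed.

(** For a box [E] reaching beyond [n], the intersection is again a box and its product splits at
    [n]; the previous lemma extends this to the sigma-algebra. *)
Lemma indep_prefix n A E : <<s boxes n >> E ->
  P (box 0 n A `&` E) = (P (box 0 n A) * P E)%E.
Proof.
have fP : (fine (P (box 0 n A)))%:E = P (box 0 n A).
  by rewrite fineK// fin_num_measure//; exact: measurable_box.
rewrite -fP; apply: indep_sigma_boxes; first exact: measurable_box.
move=> {}E [l [A' ->]]; rewrite fP.
have [nl|/ltnW ln] := leqP n l; last first.
  rewrite (_ : box n l A' = setT); first by rewrite setIT probability_setT mule1.
  apply/seteqP; split => // w _ i /andP[ni il].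
  by have := leq_trans (leq_trans il ln) ni; rewrite ltnn.
rewrite (_ : box 0 n A `&` box n l A' = box 0 l (fun i => if (i < n)%N then A i else A' i)).
  rewrite !indep_Z (@big_cat_nat _ _ _ n)//=; congr (_ * _)%E.
    by apply: eq_big_nat => i /andP[_ ->].
  by apply: eq_big_nat => i /andP[ni _]; rewrite ltnNge ni.
apply/seteqP; split => w /=.
  by move=> [h h'] i /= il; case: ltnP => ni; [apply: h|apply: h'; rewrite ni].
move=> h; split=> i /=.
  by move=> lin; have := h i; rewrite /= lin; apply; exact: leq_trans lin nl.
by move=> /andP[ni il]; have := h i; rewrite /= il ltnNge ni; apply.
Qed.

(** Entries below [n] are constant, the others are measurable for the sigma-algebra of [boxes n],
    and the limit of the partial sums inherits this. *)
Lemma sigma_boxes_pierce n a B : measurable B ->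
  <<s boxes n >> ((fun w => pierce R 0 (splice n a (Z^~ w))) @^-1` B).
Proof.
move=> mB.
have coord i : measurable_fun setT
    (fun w : g_sigma_algebraType (boxes n) => (splice n a (Z^~ w) i).+1%:R : R).
  rewrite /splice; case: ltnP => ni; first exact: measurable_cst.
  move=> _ Y mY; rewrite setTI; apply: sub_sigma_algebra.
  exists i.+1, (fun j => if j == i then [set m | Y m.+1%:R] else setT).
  apply/seteqP; split => w /=.
    by move=> Yw j /andP[_ _]; case: eqP => [->|].
  by move=> /(_ i); rewrite eqxx; apply; rewrite ni /=.
have mX : measurable_fun setT
    (fun w : g_sigma_algebraType (boxes n) => pierce R 0 (splice n a (Z^~ w))).
  apply: (measurable_limn
    (h := fun m (w : g_sigma_algebraType (boxes n)) => pierce_part R m 0 (splice n a (Z^~ w)))) => m.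
  under eq_fun do rewrite pierce_partE.
  apply: measurable_sum => k; apply: measurable_funM => //.
  apply: measurable_inv; apply: measurable_prod => j _.
  by apply: measurable_funD => //; exact: measurable_sum.
by have := mX measurableT B mB; rewrite setTI.
Qed.

Let X (w : T) : R := pierce R 0 (Z^~ w).

Let sub_sigma_boxes n E : <<s boxes n >> E -> measurable E.
Proof.
apply: smallest_sub => [|_ [l [A ->]]]; last exact: measurable_box.
exact: sigma_algebra_measurable.
Qed.

Lemma measurable_pierce B : measurable B -> measurable (X @^-1` B).
Proof. by move=> mB; apply: (@sub_sigma_boxes 0); exact: (@sigma_boxes_pierce 0 (fun=> 0%N)). Qed.

Let cyl n (a : nat -> nat) : set T := box 0 n (fun i => [set a i]).

Let cyl_splice n a w : cyl n a w -> Z^~ w = splice n a (Z^~ w).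
Proof.
by move=> aw; apply/funext => i; rewrite /splice; case: ltnP => // ni; exact: aw.
Qed.

(** Coding prefixes of length [n] by naturals turns sums over prefixes into series over [nat]; a
    code of no attained prefix gives the empty set. *)
Let slice n k : set T := [set w | choice.pickle (mkseq (Z^~ w) n) = k].

Let slice_cyl n k : slice n k = set0 \/ exists a, slice n k = cyl n a.
Proof.
have [[w0 kw0]|none] := pselect (exists w, slice n k w); last first.
  by left; apply/seteqP; split => // w kw; apply: none; exists w.
right; exists (Z^~ w0); apply/seteqP; split => w.
  rewrite /slice /= -kw0 => /(pcan_inj choice.pickleK) ww0 i /= ni.
  by have /(congr1 (nth 0%N ^~ i)) := ww0; rewrite !nth_mkseq.
move=> ww0; rewrite /slice /= -kw0; congr (choice.pickle _).
by apply/eq_in_map => i; rewrite mem_iota => /= ni; exact: ww0.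
Qed.

Let measurable_slice n k : measurable (slice n k).
Proof. by have [->|[a ->]] := slice_cyl n k => //; exact: measurable_box. Qed.

Let sum_slice n E : measurable E -> P E = (\sum_(k <oo) P (E `&` slice n k))%E.
Proof.
move=> mE; have EU : E = \bigcup_k (E `&` slice n k).
  rewrite -setI_bigcupr (_ : \bigcup_k _ = setT) ?setIT//.
  by apply/seteqP; split => // w _; exists (choice.pickle (mkseq (Z^~ w) n)).
rewrite [in LHS]EU measure_semi_bigcup//.
- by move=> k; apply: measurableI => //; exact: measurable_slice.
- apply: trivIset_setIl; apply/trivIsetP => i j _ _ ij.
  apply/seteqP; split => // w [/= wi wj].
  by move/eqP : ij; apply; rewrite -wi -wj.
- by rewrite -EU.
Qed.

(** * A maximal member of the ideal *)

Section maximal.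
Variable I : set (set R).
Hypothesis measurable_I : forall N, I N -> measurable N.
Hypothesis bigcup_I : forall N : nat -> set R, (forall k, I (N k)) -> I (\bigcup_k N k).
Hypothesis splice_I : forall n a b N, I N -> exists2 N', I N' &
  forall e, N (pierce R 0 (splice n a e)) -> N' (pierce R 0 (splice n b e)).

Let measurable_XI N : I N -> measurable (X @^-1` N).
Proof. by move=> IN; apply: measurable_pierce; exact: measurable_I. Qed.

(** A countable union of sets nearly attaining the supremum attains it and stays in [I]. *)
Lemma exists_maximal N0 : I N0 -> exists2 N, I N &
  forall N', I N' -> (P (X @^-1` N') <= P (X @^-1` N))%E.
Proof.
move=> IN0; pose S := [set P (X @^-1` N) | N in I].
have S1 : (ereal_sup S <= 1)%E.
  by apply: ge_ereal_sup => _ [N IN <-]; exact/probability_le1/measurable_XI.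
have S0 : (0 <= ereal_sup S)%E.
  by apply: (@le_trans _ _ (P (X @^-1` N0))) => //; apply: ereal_sup_ubound; exists N0.
have Sfin : ereal_sup S \is a fin_num.
  by rewrite ge0_fin_numE// (le_lt_trans S1)// ltry.
have /choice[F FP] : forall k : nat, exists N, I N /\
    (ereal_sup S - k.+1%:R^-1%:E < P (X @^-1` N))%E.
  move=> k; have k0 : 0 < k.+1%:R^-1 :> R by rewrite invr_gt0.
  by have [_ [N IN <-] hN] := ub_ereal_sup_adherent k0 Sfin; exists N.
have IF : I (\bigcup_k F k) by apply: bigcup_I => k; have [] := FP k.
exists (\bigcup_k F k) => // N' IN'.
apply: (@le_trans _ _ (ereal_sup S)); first by apply: ereal_sup_ubound; exists N'.
apply/lee_addgt0Pr => e e0.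
have [k ke] : exists k : nat, k.+1%:R^-1 < e.
  exists (Num.truncn e^-1).
  by rewrite invf_plt ?posrE//; exact: truncnS_gt.
have [IFk /ltW] := FP k; rewrite leeBlDr// => /le_trans; apply.
apply: leeD; last by rewrite lee_fin ltW.
apply: le_measure; rewrite ?inE; do ?exact: measurable_XI.
by move=> w Fw; exists k.
Qed.

Lemma zero_one_law N0 : I N0 -> P (X @^-1` N0) <> 0%E ->
  exists2 N, I N & P (X @^-1` N) = 1%E.
Proof.
move=> IN0 PN0; have [N IN maxN] := exists_maximal IN0; exists N => //.
pose A := X @^-1` N; have mA : measurable A by exact: measurable_XI.
(* Independence carries [N] on prefix [a] to [N'] on prefix [b], and maximality of
   [N] makes [N'] negligible outside [N]. *)
have cyl_le n a b : (P (A `&` cyl n a) * P (cyl n b) <= P (A `&` cyl n b) * P (cyl n a))%E.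
  have [N' IN' NN'] := splice_I n a b IN.
  pose Y c w := pierce R 0 (splice n c (Z^~ w)).
  have onY c B : cyl n c `&` X @^-1` B = cyl n c `&` Y c @^-1` B.
    by apply/seteqP; split => w [cw]; rewrite /X /Y /= -(cyl_splice cw).
  have sY c B : measurable B -> <<s boxes n >> (Y c @^-1` B) by exact: sigma_boxes_pierce.
  have mN := measurable_I IN; have mN' := measurable_I IN'.
  rewrite setIC onY indep_prefix; last exact: sY.
  apply: (@le_trans _ _ (P (cyl n a) * (P (cyl n b) * P (Y b @^-1` N')))%E).
    rewrite -muleA lee_wpmul2l// muleC lee_wpmul2l//.
    apply: le_measure; rewrite ?inE; last by move=> w; exact: NN'.
      exact: sub_sigma_boxes (sY _ _ mN).
    exact: sub_sigma_boxes (sY _ _ mN').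
  rewrite -indep_prefix; last exact: sY.
  rewrite muleC lee_wpmul2r// -onY.
  have mX' := measurable_pierce mN'.
  have mAb : measurable (A `&` cyl n b) by apply: measurableI => //; exact: measurable_box.
  have mD : measurable (X @^-1` N' `\` A) by exact: measurableD.
  have D0 : P (X @^-1` N' `\` A) = 0%E.
    (* [U] is the union of [N] and [N']; positive mass outside [A] would make it beat the
       maximum. *)
    pose U := \bigcup_(k : nat) (if k is 0%N then N else N').
    have IU : I U by apply: bigcup_I => -[].
    have := maxN _ IU; apply: contra_leP => D0.
    rewrite (_ : X @^-1` U = A `|` (X @^-1` N' `\` A)); last first.
      apply/seteqP; split => w.
        move=> [[|k] _] /= h; first by left.
        by have [|] := pselect (A w); [left|right].
      by move=> [h|[h _]]; [exists 0%N|exists 1%N].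
    rewrite measureU//; last by rewrite setDE setICA setICr setI0.
    rewrite [ltLHS](_ : _ = P A)// lteDl ?fin_num_measure//.
    by rewrite lt0e measure_ge0 andbT; apply/eqP.
  apply: (@le_trans _ _ (P ((A `&` cyl n b) `|` (X @^-1` N' `\` A)))).
    apply: le_measure; rewrite ?inE; [|exact: measurableU|].
      by apply: measurableI => //; exact: measurable_box.
    by move=> w [bw N'w]; have [Aw|nAw] := pselect (A w); [left|right].
  apply: (le_trans (measureU2 _ _ _)) => //.
  by rewrite [X in (_ + X)%E]D0 adde0.
have finP B : measurable B -> P B = (fine (P B))%:E.
  by move=> mB; rewrite fineK// fin_num_measure.
have indep_cyl n a : P (A `&` cyl n a) = (P A * P (cyl n a))%E.
  have mcyl c : measurable (cyl n c) by exact: measurable_box.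
  have mI : measurable (A `&` cyl n a) by exact: measurableI.
  (* The cross-multiplied form covers prefixes of probability 0; summing it over the slices gives
     independence. *)
  have eqk k : (P (A `&` cyl n a) * P (slice n k) = P (A `&` slice n k) * P (cyl n a))%E.
    have [->|[b ->]] := slice_cyl n k; first by rewrite setI0 !measure0 mule0 mul0e.
    by apply/eqP; rewrite eq_le !cyl_le.
  rewrite -[LHS]mule1 -(probability_setT P) (sum_slice n measurableT).
  rewrite (finP _ mI) -nneseriesZl// -(finP _ mI).
  under eq_eseriesr do rewrite setTI eqk muleC.
  by rewrite (finP _ (mcyl a)) nneseriesZl// -(sum_slice n mA) muleC.
(* A slice of length [l] is inside the box or disjoint from it. *)
have indep_box E : boxes 0 E -> P (A `&` E) = ((fine (P A))%:E * P E)%E.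
  move=> [l [A' ->]]; have mE := measurable_box 0 l A'.
  rewrite (sum_slice l (measurableI _ _ mA mE)) (sum_slice l mE) -nneseriesZl//.
  apply: eq_eseriesr => k _; rewrite -finP// -setIA.
  have [->|[a ->]] := slice_cyl l k; first by rewrite !setI0 measure0 mule0.
  have [aA'|naA'] := pselect (forall i, (i < l)%N -> A' i (a i)).
    rewrite (_ : box 0 l A' `&` cyl l a = cyl l a) ?indep_cyl//.
    apply/seteqP; split => [w []//|w aw]; split=> // i il.
    by rewrite aw//; exact: aA'.
  rewrite (_ : box 0 l A' `&` cyl l a = set0) ?setI0 ?measure0 ?mule0//.
  apply/seteqP; split => // w [A'w aw]; apply: naA' => i il.
  by rewrite -(aw i il); exact: A'w.
(* [A] lies in the generated sigma-algebra, so it is independent of itself. *)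
have := @indep_sigma_boxes 0 A _ mA indep_box A
  (@sigma_boxes_pierce 0 (fun=> 0%N) _ (measurable_I IN)).
rewrite setIid -finP// => PAA.
have PA0 : P A <> 0%E.
  by move=> PA0; apply: PN0; apply/eqP; rewrite eq_le measure_ge0 andbT -PA0; exact: maxN.
move: PAA PA0; rewrite -/A (finP _ mA) -EFinM => -[] r rn.
congr (_%:E); apply: (mulfI (x := fine (P A))).
  by apply/eqP => r0; apply: rn; rewrite r0.
by rewrite mulr1.
Qed.

End maximal.

End zero_one.

(** * The digits of the random series *)

(** The fibre over [n > 0] is [[n, n + 1[]; over 0 it is everything below 1, since negative reals
    truncate to 0. *)
Lemma measurable_truncn_preimage (R : realType) (B : set nat) :
  measurable ([set x : R | B (Num.truncn x)]).
Proof.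
rewrite (_ : [set x | _] = \bigcup_(n in B)
    ((if n is n'.+1 then `[n'.+1%:R, +oo[ else setT) `\` `[n.+1%:R, +oo[)%classic).
  apply: bigcup_measurable => n _; apply: measurableD; last exact: measurable_itv.
  by case: n => [|n]; [exact: measurableT|exact: measurable_itv].
have truncE (x : R) n : ((if n is n'.+1 then `[n'.+1%:R, +oo[ else setT)
    `\` `[n.+1%:R, +oo[)%classic x <-> Num.truncn x = n.
  split=> [[lo /negP]|<-].
    rewrite in_itv/= andbT -truncn_gt_nat -leqNgt => hi.
    apply/eqP; rewrite eqn_leq hi/=.
    by case: n lo {hi} => // n; rewrite /= in_itv/= andbT -truncn_gt_nat.
  split; last by rewrite /= in_itv/= andbT -truncn_gt_nat ltnn.
  case E: (Num.truncn x) => [//|m].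
  by rewrite /= in_itv/= andbT -truncn_gt_nat E.
apply/seteqP; split => [x Bx|x [n Bn /truncE xn]]; last by rewrite /= xn.
by exists (Num.truncn x) => //; exact/truncE.
Qed.

Section digits.
Context (R : realType) d (T : measurableType d) (P : probability T R).
Variable xi : nat -> {RV P >-> R}.

(** The predecessor matches the encoding of [pierce], and truncation makes the digit total on
    [T]. *)
Definition digit k (w : T) : nat := (Num.truncn (xi k w)).-1.

Lemma digit_preimage k B :
  digit k @^-1` B = xi k @^-1` [set x | B (Num.truncn x).-1].
Proof. by []. Qed.

Lemma measurable_digit k B : measurable (digit k @^-1` B).
Proof.
rewrite digit_preimage -[X in measurable X]setTI.
apply: measurable_funPT => //.
exact: (@measurable_truncn_preimage R (fun n => B n.-1)).
Qed.

Lemma indep_digit n l A : mutually_independent xi ->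
  P (box digit n l A) = (\prod_(n <= i < l) P (digit i @^-1` A i))%E.
Proof.
move=> /(_ [fset i in index_iota n l]%fset (fun i => [set x | A i (Num.truncn x).-1])).
rewrite (_ : \bigcap_(i in _) _ = box digit n l A); last first.
  apply/seteqP; split => w h i.
    by move=> nil; apply: (h i); rewrite /= !inE mem_index_iota.
  by rewrite /= !inE mem_index_iota; exact: h.
move=> ->; last by move=> i; exact: (@measurable_truncn_preimage R (fun n => A i n.-1)).
apply: perm_big; apply: uniq_perm; [exact: fset_uniq|exact: iota_uniq|].
by move=> i; rewrite !inE.
Qed.

Lemma ostrogradsky_sum_pierce w : (forall k, xi k w = (digit k w).+1%:R) ->
  ostrogradsky_sum xi w = pierce R 0 (digit^~ w).
Proof.
move=> xiw; rewrite /ostrogradsky_sum /pierce.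
suff -> : series (ostrogradsky_term xi ^~ w) = (fun n => pierce_part R n 0 (digit^~ w)) by [].
apply/funext => n; rewrite pierce_partE /series /= big_mkord.
apply: eq_bigr => k _; rewrite /ostrogradsky_term; congr (_ / _).
by apply: eq_bigr => j _; rewrite add0r; apply: eq_bigr => i _; exact: xiw.
Qed.

End digits.

(** * The zero-one law for the distribution of the series *)

Lemma probability_preimage_ae d (T : measurableType d) (R : realType)
    (P : probability T R) (W A B : set T) :
  measurable W -> measurable A -> measurable B -> P (~` W) = 0%E ->
  (forall w, W w -> A w <-> B w) -> P A = P B.
Proof.
move=> mW mA mB W0.
have le C D : measurable C -> measurable D -> (forall w, W w -> C w -> D w) -> (P C <= P D)%E.
  move=> mC mD CD; apply: (@le_trans _ _ (P (D `|` ~` W))).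
    apply: le_measure; rewrite ?inE//; first by apply: measurableU => //; exact: measurableC.
    by move=> w Cw; have [/CD|] := pselect (W w); [left; auto|right].
  apply: (le_trans (measureU2 _ _ _)) => //; first exact: measurableC.
  by rewrite [X in (_ + X)%E]W0 adde0.
by move=> AB; apply/eqP; rewrite eq_le !le// => w /AB[].
Qed.

(** Since the [p m k] sum to 1, almost surely all [xi k] are positive integers; there the series
    equals [pierce] of the digits, to which the zero-one law applies. *)
Lemma pure_law (R : realType) d (T : measurableType d) (P : probability T R)
    (xi : nat -> {RV P >-> R}) (p : nat -> nat -> R) (I : set (set R)) (N0 : set R) :
  mutually_independent xi ->
  (forall k : nat, (\sum_(1 <= m <oo) (p m k)%:E = 1)%E) ->
  (forall m k : nat, (0 < m)%N -> P (xi k @^-1` [set m%:R]) = (p m k)%:E) ->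
  (forall N, I N -> measurable N) ->
  (forall N : nat -> set R, (forall k, I (N k)) -> I (\bigcup_k N k)) ->
  (forall n a b N, I N -> exists2 N', I N' &
     forall e, N (pierce R 0 (splice n a e)) -> N' (pierce R 0 (splice n b e))) ->
  I N0 -> distribution P (ostrogradsky_sum xi) N0 <> 0%E ->
  exists2 N, I N & distribution P (ostrogradsky_sum xi) (~` N) = 0%E.
Proof.
move=> indep p1 law mI bigI splI IN0 N0pos.
pose G k := \bigcup_m (xi k @^-1` [set m.+1%:R]).
have mxi k x : measurable (xi k @^-1` [set x]).
  by rewrite -[X in measurable X]setTI; exact: measurable_funPT.
have mG k : measurable (G k) by apply: bigcupT_measurable => m; exact: mxi.
have G1 k : P (G k) = 1%E.
  rewrite -(p1 k) /G measure_semi_bigcup//; last 2 first.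
  - apply/trivIsetP => i j _ _ ij; apply/seteqP; split => // w [/= -> /eqP].
    by rewrite eqr_nat eqSS (negbTE ij).
  - exact: mG.
  (* The law is given for [m >= 1], so it is substituted inside the partial sums, where this bound
     on [m] is available. *)
  rewrite (_ : \sum_(1 <= m <oo) _ = \sum_(1 <= m <oo) P (xi k @^-1` [set m%:R]))%E.
    rewrite -[RHS](@nneseries_addn _ (fun m => P (xi k @^-1` [set m%:R])) 1)//.
    by apply: eq_eseriesr => m _; rewrite addn1.
  congr (limn _); apply/funext => n; apply: eq_big_nat => m /andP[m0 _].
  by rewrite law.
pose W := \bigcap_k G k.
have mW : measurable W by exact: bigcapT_measurable.
have W0 : P (~` W) = 0%E.
  rewrite setC_bigcap; apply/eqP; rewrite eq_le measure_ge0 andbT.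
  have mCG k : measurable (~` G k) by exact: measurableC.
  apply: (le_trans (measure_sigma_subadditive P mCG (bigcupT_measurable _ mCG)
    (@subset_refl _ _))).
  rewrite eseries0// => k _ _; apply: etrans (probability_setC P (mG k)) _.
  by rewrite G1 subee.
have xiE w : W w -> forall k, xi k w = (digit xi k w).+1%:R.
  by move=> Ww k; have [m _ /= xim] := Ww k Logic.I; rewrite /digit xim natrK.
have mdigit : forall k B, measurable (digit xi k @^-1` B) by move=> k B; exact: measurable_digit.
have ind n l A := indep_digit n l A indep.
have muE N : I N -> distribution P (ostrogradsky_sum xi) N =
    P ((fun w => pierce R 0 (digit xi ^~ w)) @^-1` N).
  move=> IN; apply: (probability_preimage_ae mW _ _ W0).
  - by rewrite -[X in measurable X]setTI; apply: measurable_funPT => //; exact: mI.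
  - exact: (measurable_pierce mdigit (mI _ IN)).
  - by move=> w Ww /=; rewrite (ostrogradsky_sum_pierce (xiE _ Ww)).
have [N IN PN] := zero_one_law mdigit ind mI bigI splI IN0 (fun h => N0pos (etrans (muE _ IN0) h)).
exists N => //; apply: etrans (probability_setC _ (mI _ IN)) _.
by apply: etrans (congr1 (fun x => 1 - x)%E (etrans (muE _ IN) PN)) _; rewrite subee.
Qed.

Theorem theorem10 (R : realType) (d : measure_display) (T : measurableType d)
    (P : probability T R) (xi : nat -> {RV P >-> R}) (p : nat -> nat -> R)
    (xi_indep : mutually_independent xi)
    (p_ge0 : forall m k : nat, (0 < m)%N -> 0 <= p m k)
    (p_sum1 : forall k : nat, (\sum_(1 <= m <oo) (p m k)%:E = 1)%E)
    (xi_law : forall m k : nat, (0 < m)%N ->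
      P (xi k @^-1` [set m%:R]) = (p m k)%:E) :
  purely_discrete (distribution P (ostrogradsky_sum xi)) \/
  purely_singular_continuous (distribution P (ostrogradsky_sum xi)) \/
  purely_absolutely_continuous (distribution P (ostrogradsky_sum xi)).
Proof.
have [[x mux]|/forallNP noatom] :=
    pselect (exists x, distribution P (ostrogradsky_sum xi) [set x] <> 0%E).
  (* An atom is a countable set of positive mass, so the ideal of countable sets applies. *)
  left; pose I : set (set R) := [set N | countable N].
  have mI N : I N -> measurable N by exact: countable_measurable.
  have bigI (N : nat -> set R) : (forall k, I (N k)) -> I (\bigcup_k N k).
    by move=> cN; apply: bigcup_countable => [|k _]; [exact: countableP|exact: cN].
  have splI := @splice_countable R.
  have Ix : I [set x] by exact: countable1.
  by have [N cN N0] := pure_law xi_indep p_sum1 xi_law mI bigI splI Ix mux; exists N.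
right; have [ac|nac] := pselect (purely_absolutely_continuous (distribution P (ostrogradsky_sum xi))).
  by right.
left; split; first by move=> x; apply: contrapT; exact: noatom.
(* Failure of absolute continuity provides a Lebesgue-null set of positive mass. *)
have [N0 nN0 muN0] : exists2 N, lebesgue_null N &
    distribution P (ostrogradsky_sum xi) N <> 0%E.
  apply: contrapT => none; apply: nac; apply/null_content_dominatesP => N mN N0.
  by apply: contrapT => muN; apply: none; exists N.
have mnull (N : set R) : lebesgue_null N -> measurable N by case.
have [N [mN N0'] muN] := pure_law xi_indep p_sum1 xi_law mnull
  (@lebesgue_null_bigcup R) (@splice_lebesgue_null R) nN0 muN0.
by exists N.
Qed.
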